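(* Let $d$ be a positive integer, let $Y_1,\ldots,Y_n$ be a random sample from the spherical Cauchy distribution $C_d^*(\phi)$ on $S^d$ with $\|\phi\|<1$, and let $\overline{Y}=n^{-1}\sum_{j=1}^nY_j$. Then the method of moments equation $$\eta_{1,d}(\|\phi\|)\frac{\phi}{\|\phi\|}=\overline{Y}$$ has the unique solution $\hat\phi_{MM}$ on the $(d+1)$-dimensional unit disc $\{\phi\in\mathbb{R}^{d+1}:\|\phi\|<1\}$, namely $$\hat\phi_{MM}=\eta_{1,d}^{-1}(\|\overline{Y}\|)\frac{\overline{Y}}{\|\overline{Y}\|},$$ where $\eta_{1,d}^{-1}(\rho)$ is the inverse of $\eta_{1,d}(\rho)$ for $0\le\rho<1$.
   Context: $S^d=\{x\in\mathbb{R}^{d+1}:\|x\|=1\}$, with $\|\cdot\|$ the Euclidean norm. For $\|\phi\|<1$, $C_d^*(\phi)$ is the distribution on $S^d$ with density with respect to surface area $$f(y;\phi)=\frac{\Gamma\{(d+1)/2\}}{2\pi^{(d+1)/2}}\left(\frac{1-\|\phi\|^2}{\|y-\phi\|^2}\right)^d,\quad y\in S^d.$$ For $0<\rho<1$, $$\eta_{1,d}(\rho)=\frac{1+\rho^2}{2\rho}\left[1-\frac{(1+\rho)^2}{1+\rho^2}F\left\{1,\frac d2;d;\frac{-4\rho}{(1-\rho)^2}\right\}\right],\qquad \eta_{1,d}(0)=0,$$ where $F$ is the Gauss hypergeometric function, given for $\gamma>\beta>0$ and $z<1$ by $F(\alpha,\beta;\gamma;z)=\frac{1}{B(\beta,\gamma-\beta)}\int_0^1t^{\beta-1}(1-t)^{\gamma-\beta-1}(1-tz)^{-\alpha}dt$,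 $B$ being the beta function. If $Y\sim C_d^*(\phi)$, then $E(Y)=\eta_{1,d}(\|\phi\|)\phi/\|\phi\|$ for $\phi\ne0$, and $E(Y)=0$ for $\phi=0$; the method of moments equation equates $E(Y)$ with the sample mean $\overline{Y}$.
   Formalization: The sample size is taken to be n ≥ 2 and the conclusion holds almost surely: when n = 1, or when all observations coincide (a null event), the sample mean has norm 1 and the equation has no solution in the open disc. *)

(* Defs.v *)
(* MathComp-Analysis, over an arbitrary realType. *)
From HB Require Import structures.
From mathcomp Require Import all_boot all_order all_algebra.
From mathcomp Require Import all_classical all_reals all_analysis.
From mathcomp Require Import measurable_realfun.

Set Implicit Arguments.
Unset Strict Implicit.
Unset Printing Implicit Defensive.

Import Order.TTheory GRing.Theory Num.Theory.
Import numFieldNormedType.Exports.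

Local Open Scope classical_set_scope.
Local Open Scope ring_scope.

(* R^n is 'rV[R]_n with the product (equivalently Borel) sigma-algebra,
   generated by the coordinate maps. *)
Definition measure_rV_display : measure_display.
Proof. exact: default_measure_display. Qed.

Section measurable_rV.
Context {R : realType} (n : nat).

Let coord (i : 'I_n) (v : 'rV[R]_n) : R := v 0 i.

Let rV_set0 : g_sigma_preimage coord set0.
Proof. exact: sigma_algebra0. Qed.

Let rV_setC A : g_sigma_preimage coord A -> g_sigma_preimage coord (~` A).
Proof. exact: sigma_algebraC. Qed.

Let rV_bigcup (F : (set 'rV[R]_n)^nat) :
  (forall i, g_sigma_preimage coord (F i)) ->
  g_sigma_preimage coord (\bigcup_i (F i)).
Proof. exact: sigma_algebra_bigcup. Qed.

HB.instance Definition _ := @isMeasurable.Build measure_rV_display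
  'rV[R]_n (g_sigma_preimage coord) rV_set0 rV_setC rV_bigcup.

Lemma measurable_coord (i : 'I_n) :
  measurable_fun [set: 'rV[R]_n] (fun v : 'rV[R]_n => v 0 i).
Proof.
move=> _ Y mY; rewrite setTI; apply: sub_sigma_algebra => /=.
rewrite -bigcup_seq/=; exists i => /=; first by rewrite mem_index_enum.
by exists Y => //; rewrite setTI.
Qed.

Lemma measurable_fun_rVP d (T : measurableType d) (f : T -> 'rV[R]_n) :
  (forall i, measurable_fun [set: T] (fun t => f t 0 i)) ->
  measurable_fun [set: T] f.
Proof.
move=> mf _ A mA; rewrite setTI.
suff : preimage_set_system [set: T] f (g_sigma_preimage coord) `<=` measurable.
  by apply; exists A => //; rewrite setTI.
rewrite -g_sigma_preimage_comp; apply: smallest_sub.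
  exact: sigma_algebra_measurable.
move=> B; rewrite -bigcup_seq/= => -[i _ [C mC <-]].
exact: mf.
Qed.

End measurable_rV.

Section euclidean.
Context {R : realType}.

(* The library's `|v| on row vectors is the sup norm. *)
Definition enorm n (v : 'rV[R]_n) : R := Num.sqrt (\sum_(i < n) v 0 i ^+ 2).

(* v / ||v||, which is 0 for v = 0. *)
Definition direction n (v : 'rV[R]_n) : 'rV[R]_n := (enorm v)^-1 *: v.

Definition cons_rV n (p : R * 'rV[R]_n) : 'rV[R]_n.+1 :=
  row_mx (const_mx p.1 : 'rV[R]_1) p.2.

Fixpoint lebesgue_rV n : set 'rV[R]_n -> \bar R :=
  match n with
  | 0 => \d_(0 : 'rV[R]_0)
  | m.+1 => pushforward (lebesgue_measure \x @lebesgue_rV m)%E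
      (fun p : measurableTypeR R * 'rV[R]_m => cons_rV p)
  end.

Definition punctured_ball n : set 'rV[R]_n := [set x | 0 < enorm x < 1].

(* Surface area on the unit sphere of R^n, as a measure on R^n carried by the
   sphere: n times the Lebesgue measure of the cone {r *: y | 0 < r < 1, y in A},
   as in the polar decomposition dx = r^(n-1) dr dsigma(y). *)
Definition surface_area n (A : set 'rV[R]_n) : \bar R :=
  (n%:R%:E * @lebesgue_rV n (@punctured_ball n `&` @direction n @^-1` A))%E.

Lemma enorm_ge0 n (v : 'rV[R]_n) : 0 <= enorm v.
Proof. exact: sqrtr_ge0. Qed.

Lemma measurable_enorm n : measurable_fun [set: 'rV[R]_n] (@enorm n).
Proof.
have mS : measurable_fun [set: R] (@Num.sqrt R).
  by apply: continuous_measurable_fun; exact: sqrt_continuous.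
apply: (measurableT_comp mS); apply: measurable_sum => i.
by apply: measurable_funX; exact: measurable_coord.
Qed.

Lemma measurable_direction n : measurable_fun [set: 'rV[R]_n] (@direction n).
Proof.
apply: measurable_fun_rVP => i.
have -> : (fun v : 'rV[R]_n => direction v 0 i) =
          (fun v => enorm v `^ (-1) * v 0 i).
  by apply/funext => v; rewrite mxE powR_inv1 ?enorm_ge0.
apply: measurable_funM; last exact: measurable_coord.
exact: (measurableT_comp (measurable_powR (-1))
                         (@measurable_enorm n)).
Qed.

Lemma measurable_punctured_ball n : measurable (@punctured_ball n).
Proof.
rewrite -[X in measurable X]setTI.
have -> : @punctured_ball n = @enorm n @^-1` `]0, 1[.
  by apply/seteqP; split => x; rewrite /punctured_ball /= in_itv.
by apply: measurable_enorm => //; exact: measurable_itv.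
Qed.

Lemma measurable_cons_rV n : measurable_fun setT
  (fun p : measurableTypeR R * 'rV[R]_n => cons_rV p).
Proof.
apply: measurable_fun_rVP => i.
case: (splitP (i : 'I_(1 + n))) => j ij.
  have -> : (fun p : measurableTypeR R * 'rV[R]_n => cons_rV p 0 i) = fst.
    apply/funext => p; rewrite /cons_rV (_ : i = lshift n j); last exact/val_inj.
    by rewrite (@row_mxEl _ 1 1 n) mxE.
  exact: measurable_fst.
have -> : (fun p : measurableTypeR R * 'rV[R]_n => cons_rV p 0 i) =
    (fun v : 'rV[R]_n => v 0 j) \o snd.
  apply/funext => p; rewrite /cons_rV (_ : i = rshift 1 j); last exact/val_inj.
  by rewrite (@row_mxEr _ 1 1 n).
exact: (measurableT_comp (measurable_coord j) measurable_snd).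
Qed.

Section lebesgue_rV_step.
Variables (n : nat) (mu : {sigma_finite_measure set 'rV[R]_n -> \bar R}).
Let c (p : measurableTypeR R * 'rV[R]_n) := cons_rV p.
Let nu : {measure set (measurableTypeR R * 'rV[R]_n)%type -> \bar R} :=
  ((@lebesgue_measure R) \x mu)%E.
Let step : set 'rV[R]_n.+1 -> \bar R := pushforward nu c.

Let mc A : measurable A -> measurable (c @^-1` A).
Proof.
by move=> mA; rewrite -[X in measurable X]setTI; exact: measurable_cons_rV.
Qed.

Let step0 : step set0 = 0%E.
Proof. by rewrite /step /pushforward preimage_set0 measure0. Qed.

Let step_ge0 A : (0 <= step A)%E.
Proof. exact: (measure_ge0 nu). Qed.

Let step_sigma_additive : semi_sigma_additive step.
Proof.
move=> F mF tF mUF; rewrite /step /pushforward preimage_bigcup.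
apply: measure_semi_sigma_additive.
- by move=> k; exact: mc.
- apply/trivIsetP => /= i j _ _ ij; rewrite -preimage_setI.
  by move/trivIsetP : tF => /(_ _ _ _ _ ij) ->//; rewrite preimage_set0.
- by rewrite -preimage_bigcup; exact: mc.
Qed.

HB.instance Definition _ := isMeasure.Build _ _ _ step
  step0 step_ge0 step_sigma_additive.

Let step_sigma_finite : sigma_finite setT step.
Proof.
pose u := fun v : 'rV[R]_n.+1 =>
  (v 0 0 : measurableTypeR R, \row_(i < n) v 0 (rshift 1 i)).
have cK : cancel c u.
  move=> [x v]; rewrite /u /c /cons_rV; congr pair => /=.
    rewrite (_ : 0 = lshift n (0 : 'I_1)); last exact/val_inj.
    by rewrite (@row_mxEl _ 1 1 n) mxE.
  by apply/rowP => i; rewrite mxE (@row_mxEr _ 1 1 n).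
have mu_ : measurable_fun setT u.
  apply: measurable_fun_pair; first exact: measurable_coord.
  apply: measurable_fun_rVP => i.
  have -> : (fun t : 'rV[R]_n.+1 => (\row_(i < n) t 0 (rshift 1 i)) 0 i) =
      (fun t : 'rV[R]_n.+1 => t 0 (rshift 1 i)).
    by apply/funext => t; rewrite mxE.
  exact: measurable_coord.
have [F TF Foo] : sigma_finite setT nu.
  have /sigma_finiteP[A [TA ndA Aoo]] := sigma_finiteT (@lebesgue_measure R).
  have /sigma_finiteP[B [TB ndB Boo]] := sigma_finiteT mu.
  exists (fun k => A k `*` B k).
    rewrite -setXTT TA TB predeqE => -[x y]; split.
      move=> [/= [k _ Akx] [l _ Bly]]; exists (maxn k l) => //; split.
      - by move: x Akx; exact/subsetPset/ndA/leq_maxl.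
      - by move: y Bly; exact/subsetPset/ndB/leq_maxr.
    by move=> [k _ []/= ? ?]; split; exists k.
  move=> k; have [? ?] := Aoo k; have [? ?] := Boo k.
  split; first exact: measurableX.
  rewrite [X in (X < _)%E](_ : _ = lebesgue_measure (A k) * mu (B k))%E.
    by rewrite lte_mul_pinfty// ge0_fin_numE.
  exact: product_measure1E.
exists (fun k => u @^-1` F k).
  by rewrite -preimage_bigcup -TF preimage_setT.
move=> k; split.
  by rewrite -[X in measurable X]setTI; apply: mu_ => //; case: (Foo k).
rewrite /step /pushforward -comp_preimage (_ : u \o c = id) ?preimage_id.
  by case: (Foo k).
by apply/funext => p /=; rewrite cK.
Qed.

HB.instance Definition _ := Measure_isSigmaFinite.Build _ _ _ step
  step_sigma_finite.

Lemma lebesgue_rV_step : exists m : {sigma_finite_measure set _ -> \bar R},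
  pushforward nu c = m.
Proof. by exists step. Qed.

End lebesgue_rV_step.

Lemma lebesgue_rV_sigma_finite_measure n :
  exists mu : {sigma_finite_measure set 'rV[R]_n -> \bar R},
    @lebesgue_rV n = mu.
Proof.
elim: n => [|n [mu lebE]] /=; first by exists (\d_(0 : 'rV[R]_0)).
by rewrite lebE; exact: lebesgue_rV_step.
Qed.

Let lebesgue_rV0 n : @lebesgue_rV n set0 = 0%E.
Proof. by have [mu ->] := lebesgue_rV_sigma_finite_measure n; exact: measure0. Qed.

Let lebesgue_rV_ge0 n A : (0 <= @lebesgue_rV n A)%E.
Proof. by have [mu ->] := lebesgue_rV_sigma_finite_measure n. Qed.

Let lebesgue_rV_sigma_additive n : semi_sigma_additive (@lebesgue_rV n).
Proof.
have [mu ->] := lebesgue_rV_sigma_finite_measure n.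
exact: measure_semi_sigma_additive.
Qed.

HB.instance Definition _ n := isMeasure.Build _ _ _ (@lebesgue_rV n)
  (@lebesgue_rV0 n) (@lebesgue_rV_ge0 n) (@lebesgue_rV_sigma_additive n).

Let lebesgue_rV_sigma_finite n : sigma_finite setT (@lebesgue_rV n).
Proof.
have [mu ->] := lebesgue_rV_sigma_finite_measure n; exact: sigma_finiteT.
Qed.

HB.instance Definition _ n := Measure_isSigmaFinite.Build _ _ _ (@lebesgue_rV n)
  (@lebesgue_rV_sigma_finite n).

Let surface_area0 n : @surface_area n set0 = 0%E.
Proof. by rewrite /surface_area preimage_set0 setI0 measure0 mule0. Qed.

Let surface_area_ge0 n A : (0 <= @surface_area n A)%E.
Proof. by rewrite /surface_area mule_ge0 ?lee_fin ?measure_ge0. Qed.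

Let surface_area_sigma_additive n : semi_sigma_additive (@surface_area n).
Proof.
move=> F mF tF mUF.
pose G i := @punctured_ball n `&` @direction n @^-1` F i.
have mpre A : measurable A -> measurable (@punctured_ball n `&` @direction n @^-1` A).
  move=> mA; apply: measurableI; first exact: measurable_punctured_ball.
  by rewrite -[X in measurable X]setTI; exact: measurable_direction.
have GU : @punctured_ball n `&` @direction n @^-1` (\bigcup_i F i) = \bigcup_i G i.
  by rewrite preimage_bigcup setI_bigcupr.
have tG : trivIset setT G.
  apply/trivIsetP => i j _ _ ij; rewrite /G setIACA -preimage_setI.
  by move/trivIsetP : tF => /(_ _ _ Logic.I Logic.I ij) ->; rewrite preimage_set0 setI0.
rewrite /surface_area GU.
under eq_fun do rewrite -ge0_sume_distrr//.
apply: cvgeZl => //; apply: measure_semi_sigma_additive => //.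
  by move=> i; exact: mpre.
by rewrite -GU; exact: mpre.
Qed.

HB.instance Definition _ n := isMeasure.Build _ _ _ (@surface_area n)
  (@surface_area0 n) (@surface_area_ge0 n) (@surface_area_sigma_additive n).

End euclidean.

Section random_sample.
Context {d d'} {T : measurableType d} {T' : measurableType d'} {R : realType}.
Variables (P : probability T R) (n : nat) (X : 'I_n -> {RV P >-> T'}).

Definition mutually_independent :=
  forall (J : {set 'I_n}) (A : 'I_n -> set T'),
    (forall i, measurable (A i)) ->
    P (\bigcap_(i in [set` J]) X i @^-1` A i) =
    (\prod_(i in J) P (X i @^-1` A i))%E.

Definition random_sample (mu : set T' -> \bar R) :=
  mutually_independent /\
  forall i A, measurable A -> distribution P (X i) A = mu A.

End random_sample.

Section spherical_cauchy.
Context {R : realType}.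
Local Notation leb := (@lebesgue_measure R).

Definition Gamma (a : R) : R :=
  \int[leb]_(t in `]0, +oo[) (t `^ (a - 1) * expR (- t)).

Definition Beta (a b : R) : R :=
  \int[leb]_(t in `]0, 1[) (t `^ (a - 1) * (1 - t) `^ (b - 1)).

(* Euler's integral, meaningful for 0 < b < c and z < 1. *)
Definition hypergeometric (a b c z : R) : R :=
  (Beta b (c - b))^-1 *
  \int[leb]_(t in `]0, 1[)
    (t `^ (b - 1) * (1 - t) `^ (c - b - 1) * (1 - t * z) `^ (- a)).

Definition spherical_cauchy_density d (phi y : 'rV[R]_d.+1) : R :=
  Gamma ((d%:R + 1) / 2) / (2 * pi `^ ((d%:R + 1) / 2)) *
  ((1 - enorm phi ^+ 2) / enorm (y - phi) ^+ 2) ^+ d.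

Definition spherical_cauchy d (phi : 'rV[R]_d.+1) (A : set 'rV[R]_d.+1) :
    \bar R :=
  (\int[@surface_area R d.+1]_(y in A) (spherical_cauchy_density phi y)%:E)%E.

Definition eta1 (d : nat) (rho : R) : R :=
  if rho == 0 then 0 else
  (1 + rho ^+ 2) / (2 * rho) *
  (1 - (1 + rho) ^+ 2 / (1 + rho ^+ 2) *
       hypergeometric 1 (d%:R / 2) d%:R (- 4 * rho / (1 - rho) ^+ 2)).

(* A genuine inverse where eta1 d is a bijection of [0, 1[. *)
Definition eta1_inv (d : nat) : R -> R :=
  'pinv_(fun=> 0) `[0, 1[ (eta1 d).

Definition sample_mean {disp} {T : measurableType disp} (P : probability T R)
    (n m : nat) (Y : 'I_n -> {RV P >-> 'rV[R]_m}) (w : T) : 'rV[R]_m :=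
  n%:R^-1 *: \sum_(j < n) Y j w.

(* At phi = 0 the left-hand side is 0, the mean of the uniform distribution. *)
Definition moment_equation d (phi ybar : 'rV[R]_d.+1) :=
  eta1 d (enorm phi) *: direction phi = ybar.

End spherical_cauchy.

(* Main.v *)
Require Import Defs.
From HB Require Import structures.
From mathcomp Require Import all_boot all_order all_algebra.
From mathcomp Require Import all_classical all_reals all_analysis.
From mathcomp Require Import measurable_realfun ring lra.

Set Implicit Arguments.
Unset Strict Implicit.
Unset Printing Implicit Defensive.

Import Order.TTheory GRing.Theory Num.Theory.
Import numFieldNormedType.Exports.

Local Open Scope classical_set_scope.
Local Open Scope ring_scope.

(** Taking the prefactors of [eta1 d rho] under Euler's integral and putting
    v = 2 t - 1 turns it into the mean, for the symmetric beta law
    B(d/2, d/2) of t, of ((1 + rho^2) v + 2 rho) / (1 + rho^2 + 2 rho v).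
    The integrand is bounded by 1 in absolute value, strictly increasing in
    rho on [0, 1], and equals v at rho = 0 and 1 at rho = 1.  So the mean
    extends to a continuous strictly increasing function on [0, 1] with value
    0 at 0 (by symmetry) and 1 at 1, whence the bijection of [0, 1[.

    Comparing norms and directions then solves the moment equation as soon as
    the sample mean lies in the open unit ball.  This holds almost surely: the
    observations are unit vectors, points are null for the surface area when
    d > 0, so by Fubini two independent observations are almost surely
    distinct, and a mean of unit vectors that are not all equal has norm less
    than 1. *)

(** * Calculus on []0, 1[] and its exhaustion by compact intervals *)

Section unit_interval.
Context {R : realType}.
Local Notation leb := (@lebesgue_measure R).

(** The bounds stay strictly inside the unit interval because powers of t and 1 - t may be singular
    at 0 and 1; the endpoints are reached later by exhaustion. *)
Lemma FTC2_oo01 (f F : R -> R) (a b : R) : 0 < a -> a < b -> b < 1 ->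
  (forall t : R, 0 < t < 1 -> is_derive t 1 F (f t)) ->
  (forall t : R, 0 < t < 1 -> {for t, continuous f}) ->
  (\int[leb]_(t in `[a, b]) (f t)%:E)%E = (F b - F a)%:E.
Proof.
move=> a0 ab b1 dF cf.
have inI (t : R) : t \in `[a, b] -> 0 < t < 1.
  rewrite in_itv/= => /andP[ta tb].
  by rewrite (lt_le_trans a0 ta) (le_lt_trans tb b1).
have cF (t : R) : t \in `[a, b] -> {for t, continuous F}.
  move=> /inI tI; apply/differentiable_continuous/derivable1_diffP.
  by have [] := dF t tI.
rewrite (@continuous_FTC2 _ f F)// ?EFinB//.
- apply: continuous_in_subspaceT => t /[!inE]/= /inI tI; exact: cf.
- split.
  + move=> t tI; have [] // := dF t (inI _ _).
    exact: subset_itv_oo_cc.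
  + apply: cvg_at_right_filter; apply: cF.
    by rewrite in_itv/= lexx ltW.
  + apply: cvg_at_left_filter; apply: cF.
    by rewrite in_itv/= lexx ltW.
- move=> t tI; rewrite derive1E.
  have tI' : 0 < t < 1 by apply: inI; exact: subset_itv_oo_cc.
  by rewrite (@derive_val _ _ _ _ _ _ _ (dF t tI')).
Qed.

(** The interval is symmetric under t -> 1 - t, which is what makes odd integrals vanish on it. The
    shift by 3 makes it nondegenerate already for n = 0. *)
Definition inner_itv (n : nat) : set R := `[n.+3%:R^-1, 1 - n.+3%:R^-1]%classic.

Lemma inner_itv_bounds n :
  [/\ 0 < n.+3%:R^-1 :> R, n.+3%:R^-1 < 1 - n.+3%:R^-1 :> R
    & 1 - n.+3%:R^-1 < 1 :> R].
Proof.
have h : 0 < n.+3%:R^-1 :> R by rewrite invr_gt0 ltr0n.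
split; [by []| |by rewrite ltrBlDr ltrDl].
rewrite ltrBrDr -mulr2n -(@ltr_pM2r _ n.+3%:R) ?ltr0n//.
by rewrite mulrnAl mulVf ?pnatr_eq0// mul1r ltr_nat.
Qed.

Lemma measurable_inner_itv n : measurable (inner_itv n).
Proof. exact: measurable_itv. Qed.

Lemma nondecreasing_inner_itv : nondecreasing_seq inner_itv.
Proof.
move=> m n mn; apply/subsetPset => t; rewrite /inner_itv/= !in_itv/=.
have h : n.+3%:R^-1 <= m.+3%:R^-1 :> R.
  by rewrite lef_pV2 ?posrE ?ltr0n// ler_nat !ltnS.
move=> /andP[tm t1]; rewrite (le_trans h tm)/=.
by rewrite (le_trans t1)// lerB.
Qed.

Lemma sub_inner_itv n : inner_itv n `<=` `]0, 1[%classic.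
Proof.
move=> t; have [h1 _ h3] := inner_itv_bounds n.
rewrite /inner_itv/= !in_itv/= => /andP[tm t1].
by rewrite (lt_le_trans h1 tm) (le_lt_trans t1 h3).
Qed.

Lemma bigcup_inner_itv : \bigcup_n inner_itv n = `]0, 1[%classic.
Proof.
apply/seteqP; split => [t [n _]|t]; first exact: sub_inner_itv.
rewrite /= in_itv/= => /andP[t0 t1].
have [k hk] : exists k : nat, (t^-1 < k%:R) && ((1 - t)^-1 < k%:R).
  exists (Num.bound (Num.max t^-1 (1 - t)^-1)).
  rewrite -gt_max.
  rewrite archi_boundP// le_max invr_ge0 ltW//.
exists k => //; rewrite /inner_itv /= in_itv/= lerBrDr.
have t1' : 0 < 1 - t by rewrite subr_gt0.
case/andP: hk => hk1 hk2.
have kk : (k%:R <= k.+3%:R :> R) by rewrite ler_nat; do 3 apply: leqW.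
apply/andP; split.
  rewrite -[leRHS]invrK lef_pV2 ?posrE ?ltr0n ?invr_gt0//.
  by rewrite ltW// (lt_le_trans hk1).
rewrite addrC -lerBrDr -[leRHS]invrK lef_pV2 ?posrE ?ltr0n ?invr_gt0//.
by rewrite ltW// (lt_le_trans hk2).
Qed.

End unit_interval.
Arguments inner_itv {R}.

(** * The symmetric beta kernel: integrability and symmetry *)

Section beta_kernel.
Context {R : realType}.
Implicit Types (b t : R).
Local Notation leb := (@lebesgue_measure R).

(** Unnormalised density of the beta law B(b, b). It is used with b = d/2, hence b >= 1/2. *)
Definition beta_kernel b t : R := t `^ (b - 1) * (1 - t) `^ (b - 1).

Lemma beta_kernelE b t : 0 < t < 1 -> beta_kernel b t = (t * (1 - t)) `^ (b - 1).
Proof. by move=> /andP[t0 t1]; rewrite powRM// ltW// subr_gt0. Qed.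

Lemma beta_kernel_ge0 b t : 0 <= beta_kernel b t.
Proof. by rewrite mulr_ge0 ?powR_ge0. Qed.

Lemma beta_kernel_gt0 b t : 0 < t < 1 -> 0 < beta_kernel b t.
Proof. by move=> /andP[t0 t1]; rewrite mulr_gt0// powR_gt0// subr_gt0. Qed.

Lemma measurable_beta_kernel b : measurable_fun setT (beta_kernel b).
Proof.
apply: measurable_funM; first exact: measurable_powR.
apply: (measurableT_comp (measurable_powR (b - 1))).
by apply: measurable_funB.
Qed.

Lemma is_derive_powR_onem b t : t < 1 ->
  is_derive t 1 (fun x : R => (1 - x) `^ b) (- (b * (1 - t) `^ (b - 1))).
Proof.
move=> t1.
have := @is_derive1_comp R (@powR R ^~ b) (fun x : R => 1 - x) t
  (b * (1 - t) `^ (b - 1)) (-1).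
rewrite mulrN1; apply.
  by apply: is_derive1_powR; rewrite subr_gt0.
have : is_derive t 1 (fun x : R => 1 - x) (0 - 1) by apply: is_deriveB.
by rewrite sub0r.
Qed.

Lemma continuous_powR b t : 0 < t -> {for t, continuous (@powR R ^~ b)}.
Proof.
move=> t0; apply/differentiable_continuous/derivable1_diffP.
by apply: derivable_powR; rewrite in_itv/= t0.
Qed.

Lemma continuous_powR_onem b t : t < 1 ->
  {for t, continuous (fun x : R => (1 - x) `^ b)}.
Proof.
move=> t1; apply/differentiable_continuous/derivable1_diffP.
by have [] := is_derive_powR_onem b t1.
Qed.

Lemma continuous_beta_kernel b t : 0 < t < 1 ->
  {for t, continuous (beta_kernel b)}.
Proof.
move=> /andP[t0 t1]; apply: (@continuousM _ _ (@powR R ^~ (b - 1)) (fun x : R => (1 - x) `^ (b - 1))).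
  exact: continuous_powR.
exact: continuous_powR_onem.
Qed.

(** Since t (1 - t) <= 1, the kernel is largest at b = 1/2. There, with s and u the square roots of
    t and 1 - t, it equals 1/(s u), and 1/(s u) <= 1/s + 1/u amounts to s + u >= 1, which follows
    from s^2 + u^2 = 1. *)
Lemma beta_kernel_le b t : 2^-1 <= b -> 0 < t < 1 ->
  beta_kernel b t <= t `^ (2^-1 - 1) + (1 - t) `^ (2^-1 - 1).
Proof.
move=> b12 t01; have /andP[t0 t1] := t01.
have t1' : 0 < 1 - t by rewrite subr_gt0.
have p0 : 0 < t * (1 - t) by rewrite mulr_gt0.
rewrite beta_kernelE//.
apply: (@le_trans _ _ ((t * (1 - t)) `^ (2^-1 - 1))).
  apply: ger_powR; last by rewrite lerD2r.
  by rewrite p0/=; nra.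
rewrite (powRM _ (ltW t0) (ltW t1')).
have -> : 2^-1 - 1 = - 2^-1 :> R by lra.
rewrite !powRN (powR12_sqrt (ltW t0)) (powR12_sqrt (ltW t1')).
set s := Num.sqrt t; set u := Num.sqrt (1 - t).
have s0 : 0 < s by rewrite sqrtr_gt0.
have u0 : 0 < u by rewrite sqrtr_gt0.
have su : s ^+ 2 + u ^+ 2 = 1 by rewrite !sqr_sqrtr ?ltW//; ring.
rewrite -subr_ge0.
have -> : s^-1 + u^-1 - s^-1 * u^-1 = (s + u - 1) / (s * u).
  by field; rewrite !gt_eqF.
apply: divr_ge0; last by rewrite mulr_ge0 ?(ltW s0) ?(ltW u0).
nra.
Qed.

Lemma integral_beta_kernel_inner b n : 2^-1 <= b ->
  (\int[leb]_(t in inner_itv n) (beta_kernel b t)%:E <= 4%:E)%E.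
Proof.
move=> b12; have [e0 e1 e2] := inner_itv_bounds (R := R) n.
set e := n.+3%:R^-1 in e0 e1 e2.
pose f (t : R) := t `^ (2^-1 - 1) + (1 - t) `^ (2^-1 - 1).
(* A primitive of the majorant [f]; its increment over the interval is 4 (sqrt (1 - e) - sqrt e), at
   most 4 for every n. *)
pose F (t : R) := 2 * t `^ 2^-1 - 2 * (1 - t) `^ 2^-1.
have mf : measurable_fun setT f.
  apply: measurable_funD; first exact: measurable_powR.
  apply: (measurableT_comp (measurable_powR _)).
  by apply: measurable_funB.
apply: (@le_trans _ _ (\int[leb]_(t in inner_itv n) (f t)%:E)%E).
  apply: ge0_le_integral.
  - exact: measurable_inner_itv.
  - by move=> t _; rewrite lee_fin beta_kernel_ge0.
  - apply/measurable_EFinP; apply: measurable_funTS; exact: measurable_beta_kernel.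
  - by apply/measurable_EFinP; exact: measurable_funTS.
  - move=> t /sub_inner_itv; rewrite /= in_itv/= => tI.
    by rewrite lee_fin beta_kernel_le.
have -> : (\int[leb]_(t in inner_itv n) (f t)%:E = (F (1 - e) - F e)%:E)%E.
  apply: FTC2_oo01 => //.
  - move=> t /andP[t0 t1].
    have -> : f t = 2 * (2^-1 * t `^ (2^-1 - 1)) - 2 * (- (2^-1 * (1 - t) `^ (2^-1 - 1))).
      by rewrite /f; field.
    apply: (@is_deriveB _ _ _ (fun t : R => 2 * t `^ 2^-1) (fun t : R => 2 * (1 - t) `^ 2^-1)).
      by apply: (@is_deriveZ _ _ _ (@powR R ^~ 2^-1)); exact: is_derive1_powR.
    by apply: (@is_deriveZ _ _ _ (fun t : R => (1 - t) `^ 2^-1)); exact: is_derive_powR_onem.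
  - move=> t /andP[t0 t1].
    apply: (@continuousD _ _ _ (@powR R ^~ _) (fun t : R => (1 - t) `^ _)).
      exact: continuous_powR.
    exact: continuous_powR_onem.
rewrite lee_fin /F subKr !powR12_sqrt; [|lra|lra].
have s1 : Num.sqrt e >= 0 by exact: sqrtr_ge0.
have u1 : Num.sqrt (1 - e) <= 1 by rewrite -[leRHS]sqrtr1 ler_sqrt// ltW.
lra.
Qed.

Lemma integral_beta_kernel_lty b : 2^-1 <= b ->
  (\int[leb]_(t in `]0%R, 1%R[) (beta_kernel b t)%:E < +oo%E)%E.
Proof.
move=> b12; rewrite -bigcup_inner_itv.
have cv : (\int[leb]_(t in inner_itv n) (beta_kernel b t)%:E @[n --> \oo] -->
    \int[leb]_(t in \bigcup_n inner_itv n) (beta_kernel b t)%:E)%E.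
  apply: ge0_nondecreasing_set_cvg_integral => //.
  - exact: nondecreasing_inner_itv.
  - exact: measurable_inner_itv.
  - by move=> n; apply/measurable_EFinP; apply: measurable_funTS; exact: measurable_beta_kernel.
  - by move=> n t _; rewrite lee_fin beta_kernel_ge0.
apply: (@le_lt_trans _ _ 4%:E); last exact: ltry.
rewrite -(cvg_lim _ cv)//; apply: lime_le; first by apply/cvg_ex; eexists; exact: cv.
by apply: nearW => n; exact: integral_beta_kernel_inner.
Qed.

Lemma integrable_beta_kernel b : 2^-1 <= b ->
  leb.-integrable `]0, 1[ (EFin \o beta_kernel b).
Proof.
move=> b12; apply/integrableP; split.
  by apply/measurable_EFinP; apply: measurable_funTS; exact: measurable_beta_kernel.
under eq_integral => t _ do rewrite /= ger0_norm ?beta_kernel_ge0//.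
exact: integral_beta_kernel_lty.
Qed.

Lemma integrable_beta_kernelM b (h : R -> R) : 2^-1 <= b ->
  measurable_fun (`]0, 1[%classic : set R) h -> (forall t, 0 < t < 1 -> `|h t| <= 1) ->
  leb.-integrable `]0, 1[ (EFin \o (fun t => h t * beta_kernel b t)).
Proof.
move=> b12 mh h1; apply: le_integrable (integrable_beta_kernel b12) => //.
  apply/measurable_EFinP; apply: measurable_funM => //.
  by apply: measurable_funTS; exact: measurable_beta_kernel.
move=> t; rewrite /= in_itv/= => t01.
rewrite lee_fin normrM ler_piMl ?normr_ge0//; exact: h1.
Qed.

Lemma integral_beta_kernel_odd_inner b n : 0 < b ->
  (\int[leb]_(t in inner_itv n) ((2 * t - 1) * beta_kernel b t)%:E = 0%:E)%E.
Proof.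
move=> b0; have [e0 e1 e2] := inner_itv_bounds (R := R) n.
rewrite /inner_itv; set e := n.+3%:R^-1 in e0 e1 e2 *.
(* The derivative of (t (1 - t))^b is -b (2 t - 1) times the kernel; this primitive takes the same
   value at e and 1 - e. *)
pose F (t : R) : R := (- b^-1) * (t `^ b * (1 - t) `^ b).
have FE : F (1 - e) - F e = 0 by rewrite /F subKr [(1 - e) `^ b * _]mulrC subrr.
rewrite -FE; apply: FTC2_oo01 => //.
- move=> t t01; have /andP[t0 t1] := t01; have t1' : 0 < 1 - t by rewrite subr_gt0.
  have -> : (2 * t - 1) * beta_kernel b t =
      (- b^-1) * (t `^ b * (- (b * (1 - t) `^ (b - 1))) +
                  (1 - t) `^ b * (b * t `^ (b - 1))).
    rewrite -(mulr_powRB1 (ltW t0) b0) -(mulr_powRB1 (ltW t1') b0) /beta_kernel.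
    by field; rewrite gt_eqF.
  apply: (@is_deriveZ _ _ _ (fun t : R => t `^ b * (1 - t) `^ b)).
  apply: (@is_deriveM _ _ (@powR R ^~ b) (fun t : R => (1 - t) `^ b)).
    exact: is_derive1_powR.
  exact: is_derive_powR_onem.
- move=> t t01; apply: (@continuousM _ _ (fun t : R => 2 * t - 1) (beta_kernel b)).
    apply: continuousB; last exact: cvg_cst.
    by apply: continuousM; [exact: cvg_cst|exact: cvg_id].
  exact: continuous_beta_kernel.
Qed.

(** Monotone convergence requires a sign, so the odd integrand is split into 2 t k and k, with k the
    kernel. Both are nonnegative and have equal integrals on each inner interval, hence equal
    integrals on []0, 1[]. *)
Lemma Rintegral_beta_kernel_odd b : 2^-1 <= b ->
  \int[leb]_(t in `]0%R, 1%R[) ((2 * t - 1) * beta_kernel b t) = 0.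
Proof.
move=> b12; have b0 : 0 < b by rewrite (lt_le_trans _ b12)// invr_gt0.
have mB := measurable_beta_kernel b.
have iB := integrable_beta_kernel b12.
have mid : measurable_fun setT (fun t : R => 2 * t - 1).
  by apply: measurable_funB => //; exact: measurable_funM.
have iO : leb.-integrable `]0, 1[ (EFin \o (fun t => (2 * t - 1) * beta_kernel b t)).
  apply: integrable_beta_kernelM => //; first exact: measurable_funTS.
  by move=> t t01; rewrite ler_norml; lra.
have iT : leb.-integrable `]0, 1[ (EFin \o (fun t : R => 2 * (t * beta_kernel b t))).
  apply: (@integrableZl _ _ _ leb _ _ 2 (fun t => (t * beta_kernel b t)%:E)) => //.
  apply: integrable_beta_kernelM => //.
  by move=> t t01; rewrite ler_norml; lra.
have eqn n : (\int[leb]_(t in inner_itv n) (2 * (t * beta_kernel b t))%:E =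
   \int[leb]_(t in inner_itv n) (beta_kernel b t)%:E)%E.
  have <- : (0%:E + \int[leb]_(t in inner_itv n) (beta_kernel b t)%:E =
     \int[leb]_(t in inner_itv n) (beta_kernel b t)%:E)%E by rewrite add0e.
  rewrite -(integral_beta_kernel_odd_inner n b0) -integralD_EFin//.
  - by apply: eq_integral => t _; congr EFin; ring.
  - exact: measurable_inner_itv.
  - apply: integrableS iO => //; [exact: measurable_inner_itv|exact: sub_inner_itv].
  - apply: integrableS iB => //; [exact: measurable_inner_itv|exact: sub_inner_itv].
have cv (f : R -> R) : measurable_fun setT f -> (forall t, 0 < t < 1 -> 0 <= f t) ->
    (\int[leb]_(t in inner_itv n) (f t)%:E @[n --> \oo] -->
     \int[leb]_(t in `]0%R, 1%R[) (f t)%:E)%E.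
  move=> mf f0; rewrite -bigcup_inner_itv.
  apply: ge0_nondecreasing_set_cvg_integral => //.
  - exact: nondecreasing_inner_itv.
  - exact: measurable_inner_itv.
  - by move=> n; apply/measurable_EFinP; exact: measurable_funTS.
  - by move=> n t /sub_inner_itv; rewrite /= in_itv/= lee_fin; exact: f0.
have c1 := cv _ mB (fun t _ => beta_kernel_ge0 b t).
have mT : measurable_fun setT (fun t : R => 2 * (t * beta_kernel b t)).
  by apply: measurable_funM => //; exact: measurable_funM.
have c2 : (\int[leb]_(t in inner_itv n) (beta_kernel b t)%:E @[n --> \oo] -->
     \int[leb]_(t in `]0%R, 1%R[) (2 * (t * beta_kernel b t))%:E)%E.
  under eq_fun do rewrite -eqn.
  apply: cv => // t /andP[t0 _].
  by rewrite mulr_ge0// mulr_ge0 ?beta_kernel_ge0// ltW.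
have E : \int[leb]_(t in `]0%R, 1%R[) (2 * (t * beta_kernel b t)) =
    \int[leb]_(t in `]0%R, 1%R[) beta_kernel b t.
  by congr fine; rewrite -(cvg_lim _ c1)// -(cvg_lim _ c2).
under eq_Rintegral => t _.
  rewrite (_ : _ * _ = 2 * (t * beta_kernel b t) - beta_kernel b t); last by ring.
  over.
by rewrite RintegralB// E subrr.
Qed.

End beta_kernel.

(** * The fractional linear integrand and its monotonicity in r *)

Section mobius.
Context {R : realType}.
Implicit Types (r s t : R).
Local Notation leb := (@lebesgue_measure R).

Definition mobius_num r t : R := 2 * r + (1 + r ^+ 2) * (2 * t - 1).
Definition mobius_den r t : R := 1 + r ^+ 2 + 2 * r * (2 * t - 1).
(** With v = 2 t - 1 and u = 2 r / (1 + r^2) this is (u + v) / (1 + u v), the velocity addition law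
    on [-1, 1]. *)
Definition mobius r t : R := mobius_num r t / mobius_den r t.

Lemma mobius_den_gt0 r t : 0 < t < 1 -> 0 < mobius_den r t.
Proof.
move=> /andP[t0 t1].
(* Completing the square in r: with v = 2 t - 1, the remainder is 1 - v^2 = 4 t (1 - t). *)
have -> : mobius_den r t = (r + (2 * t - 1)) ^+ 2 + 4 * (t * (1 - t)).
  by rewrite /mobius_den; ring.
by rewrite ltr_wpDl ?sqr_ge0// !mulr_gt0// subr_gt0.
Qed.

Lemma mobius_norm_le1 r t : 0 < t < 1 -> `|mobius r t| <= 1.
Proof.
move=> t01; have D0 := mobius_den_gt0 r t01; have /andP[t0 t1] := t01.
rewrite normrM normfV (gtr0_norm D0) ler_pdivrMr// mul1r.
rewrite -ler_sqr ?nnegrE ?normr_ge0 ?(ltW D0)// real_normK ?num_real//.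
rewrite -subr_ge0.
have -> : mobius_den r t ^+ 2 - mobius_num r t ^+ 2 =
    4 * (1 - r ^+ 2) ^+ 2 * (t * (1 - t)).
  by rewrite /mobius_den /mobius_num; ring.
by rewrite mulr_ge0// mulr_ge0 ?sqr_ge0// ?subr_ge0 ltW.
Qed.

Lemma mobius_lt r s t : 0 < t < 1 -> 0 <= r -> r < s -> s <= 1 ->
  mobius r t < mobius s t.
Proof.
move=> t01 r0 rs s1; have Dr := mobius_den_gt0 r t01.
have Ds := mobius_den_gt0 s t01; have /andP[t0 t1] := t01.
rewrite -subr_gt0.
(* The difference factors completely; the factor 1 - r s is where 0 <= r < s <= 1 enters. *)
have -> : mobius s t - mobius r t =
    8 * (s - r) * (1 - r * s) * (t * (1 - t)) / (mobius_den s t * mobius_den r t).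
  move: Dr Ds; rewrite /mobius /mobius_num /mobius_den => Dr Ds.
  by field; rewrite !gt_eqF.
have sr : 0 < s - r by rewrite subr_gt0.
have t1' : 0 < 1 - t by rewrite subr_gt0.
have rs1 : 0 < 1 - r * s by nra.
by rewrite divr_gt0 ?mulr_gt0.
Qed.

Lemma mobius0 t : mobius 0 t = 2 * t - 1.
Proof.
by rewrite /mobius /mobius_num /mobius_den expr0n/= !(mulr0, mul0r, addr0, add0r) mul1r divr1.
Qed.

Lemma mobius1 t : 0 < t < 1 -> mobius 1 t = 1.
Proof.
move=> /(mobius_den_gt0 1) D0; rewrite /mobius.
have -> : mobius_num 1 t = mobius_den 1 t by rewrite /mobius_num /mobius_den; ring.
by rewrite divff// gt_eqF.
Qed.

Lemma measurable_mobius_den_inv r :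
  measurable_fun (`]0, 1[%classic : set R) (fun t => (mobius_den r t)^-1).
Proof.
have mlin : measurable_fun setT (fun t : R => 2 * t - 1).
  by apply: measurable_funB => //; exact: measurable_funM.
have mD : measurable_fun setT (mobius_den r).
  by apply: measurable_funD => //; exact: measurable_funM.
(* The real power with exponent -1 is measurable everywhere and agrees with the inverse where the
   denominator is positive. *)
have mV : measurable_fun setT (fun t => mobius_den r t `^ (-1)).
  exact: (measurableT_comp (measurable_powR (-1)) mD).
apply: eq_measurable_fun (measurable_funTS mV) => t.
by rewrite inE/= in_itv/= => t01; rewrite powR_inv1// ltW// mobius_den_gt0.
Qed.

Lemma measurable_mobius r : measurable_fun (`]0, 1[%classic : set R) (mobius r).
Proof.
have mlin : measurable_fun setT (fun t : R => 2 * t - 1).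
  by apply: measurable_funB => //; exact: measurable_funM.
apply: measurable_funM; last exact: measurable_mobius_den_inv.
apply: measurable_funTS.
by apply: measurable_funD => //; exact: measurable_funM.
Qed.

Lemma continuous_mobius t r : 0 < t < 1 -> {for r, continuous (mobius ^~ t)}.
Proof.
move=> t01.
have c1 : continuous (fun r : R => 1 + r ^+ 2 : R).
  by move=> x; apply: cvgD; [exact: cvg_cst|exact: exprn_continuous].
have c2 : continuous (fun r : R => 2 * r : R).
  by move=> x; apply: cvgM; [exact: cvg_cst|exact: cvg_id].
apply: (@continuousM _ _ (mobius_num ^~ t) (fun r => (mobius_den r t)^-1)).
  apply: cvgD; first exact: c2.
  by apply: cvgM; [exact: c1|exact: cvg_cst].
apply: continuousV; first by rewrite gt_eqF// mobius_den_gt0.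
apply: cvgD; first exact: c1.
by apply: cvgM; [exact: c2|exact: cvg_cst].
Qed.

End mobius.

(** * Integral representation of [eta1] and its bijectivity on [[0, 1[] *)

Section eta1_bijection.
Context {R : realType}.
Implicit Types (r s t : R).
Local Notation leb := (@lebesgue_measure R).

(** If the integral were 0, f would vanish almost everywhere on []0, 1[]; as it vanishes nowhere
    there, this interval of measure 1 would lie in a null set. *)
Lemma Rintegral_gt0_oo01 (f : R -> R) :
  leb.-integrable `]0, 1[ (EFin \o f) -> (forall t, 0 < t < 1 -> 0 < f t) ->
  0 < \int[leb]_(t in `]0, 1[) f t.
Proof.
move=> fi f0.
have mI : measurable (`]0, 1[%classic : set R) by exact: measurable_itv.
have fI t : (`]0, 1[%classic : set R) t -> 0 < f t by rewrite /= in_itv; exact: f0.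
have I0 : 0 <= \int[leb]_(t in `]0, 1[) f t.
  by apply: Rintegral_ge0 => t /fI/ltW.
rewrite lt_neqAle I0 andbT; apply/negP => /eqP I0E.
have mf := measurable_int _ fi.
have abs0 : (\int[leb]_(t in `]0%R, 1%R[) `|(EFin \o f) t| = 0)%E.
  transitivity (\int[leb]_(t in `]0%R, 1%R[) (f t)%:E)%E.
    apply: eq_integral.
    by move=> t; rewrite inE => /fI ft; rewrite /= ger0_norm// ltW.
  rewrite -[LHS]fineK; last exact: integrable_fin_num.
  by rewrite -[fine _]/(\int[leb]_(t in `]0, 1[) f t) -I0E.
have [/(_ abs0) + _] := ae_eq_integral_abs leb mI mf.
move=> [N [mN N0 sN]].
have : (leb (`]0%R, 1%R[%classic : set R) <= leb N)%E.
  apply: le_measure; rewrite ?inE// => t tI; apply: sN => /(_ tI)/= [ft].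
  by have := fI t tI; rewrite ft ltxx.
rewrite [leRHS]N0 lebesgue_measure_itv/= lte_fin ltr01 oppr0 adde0.
by rewrite leNgt lte_fin ltr01.
Qed.

(** Left unnormalised: division by [Beta b b] turns it into the mean under the beta law. *)
Definition mobius_mean b r : R :=
  \int[leb]_(t in `]0, 1[) (mobius r t * beta_kernel b t).

Lemma integrable_mobius_kernel b r : 2^-1 <= b ->
  leb.-integrable `]0, 1[ (EFin \o (fun t => mobius r t * beta_kernel b t)).
Proof.
move=> b12; apply: integrable_beta_kernelM => //; first exact: measurable_mobius.
by move=> t; exact: mobius_norm_le1.
Qed.

Lemma Beta_gt0 b : 2^-1 <= b -> 0 < @Beta R b b.
Proof.
move=> b12; apply: Rintegral_gt0_oo01; first exact: integrable_beta_kernel.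
by move=> t; exact: beta_kernel_gt0.
Qed.

Lemma mobius_mean_lt b r s : 2^-1 <= b -> 0 <= r -> r < s -> s <= 1 ->
  mobius_mean b r < mobius_mean b s.
Proof.
move=> b12 r0 rs s1; rewrite -subr_gt0 /mobius_mean -RintegralB//; last 2 first.
- exact: integrable_mobius_kernel.
- exact: integrable_mobius_kernel.
apply: Rintegral_gt0_oo01.
  have mI : measurable (`]0, 1[%classic : set R) by exact: measurable_itv.
  have iB := @integrableB _ _ _ leb _ mI _ _
    (integrable_mobius_kernel s b12) (integrable_mobius_kernel r b12).
  apply: eq_integrable iB => //.
move=> t t01; rewrite -mulrBl mulr_gt0 ?beta_kernel_gt0// subr_gt0.
exact: mobius_lt.
Qed.

Lemma mobius_mean0 b : 2^-1 <= b -> mobius_mean b 0 = 0.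
Proof.
move=> b12; rewrite -[RHS](Rintegral_beta_kernel_odd b12).
by apply: eq_Rintegral => t _; rewrite mobius0.
Qed.

Lemma mobius_mean1 b : mobius_mean b 1 = @Beta R b b.
Proof.
apply: eq_Rintegral => t; rewrite inE/= in_itv/= => t01.
by rewrite mobius1// mul1r.
Qed.

Lemma continuous_mobius_mean b r : 2^-1 <= b -> {for r, continuous (mobius_mean b)}.
Proof.
move=> b12.
(* Dominated convergence with the kernel as majorant, valid for every parameter; the window of
   radius 1 around r is an arbitrary choice. *)
apply: (@continuity_under_integral R _ _ leb (fun r t => mobius r t * beta_kernel b t)
   `]0, 1[ _ (r - 1) (r + 1) _ _ (beta_kernel b)) => //.
- by move=> s _; exact: integrable_mobius_kernel.
- apply: aeW => t; rewrite /= in_itv/= => t01 s _.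
  apply: (@continuousM _ _ (mobius ^~ t) (fun=> beta_kernel b t)).
    exact: continuous_mobius.
  exact: cvg_cst.
- exact: integrable_beta_kernel.
- move=> s _; apply: aeW => t; rewrite /= in_itv/= => t01.
  rewrite normrM (ger0_norm (beta_kernel_ge0 _ _)) ler_piMl ?beta_kernel_ge0//.
  exact: mobius_norm_le1.
- by rewrite inE/= in_itv/= ltrBlDr ltrDl ltr01 andbT.
Qed.

Lemma eta1E (d : nat) r : (0 < d)%N -> 0 <= r < 1 ->
  eta1 d r = (Beta (d%:R / 2) (d%:R / 2))^-1 * mobius_mean (d%:R / 2) r.
Proof.
move=> d0 /andP[r0 r1].
have b12 : 2^-1 <= d%:R / 2 :> R by rewrite -[leLHS]mul1r ler_pM2r ?invr_gt0// ler1n.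
rewrite /eta1; case: eqVneq => [->|rN0]; first by rewrite mobius_mean0 ?mulr0.
have {rN0}r0 : 0 < r by rewrite lt_neqAle eq_sym rN0.
rewrite /hypergeometric.
have -> : d%:R - d%:R / 2 = d%:R / 2 :> R by field.
set b := d%:R / 2 in b12 *.
have B0 := Beta_gt0 b12.
(* This is Euler's integrand at the given z, because 1 - t z = [mobius_den r t] / (1 - r)^2. *)
pose h t : R := (1 - r) ^+ 2 / mobius_den r t * beta_kernel b t.
set z := -4 * r / (1 - r) ^+ 2.
have r1' : 0 < 1 - r by rewrite subr_gt0.
have -> : \int[leb]_(t in `]0, 1[)
    (t `^ (b - 1) * (1 - t) `^ (b - 1) * (1 - t * z) `^ (- 1)) =
    \int[leb]_(t in `]0, 1[) h t.
  apply: eq_Rintegral => t; rewrite inE/= in_itv/= => t01.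
  have D0 := mobius_den_gt0 r t01.
  have -> : 1 - t * z = mobius_den r t / (1 - r) ^+ 2.
    by rewrite /z /mobius_den; field; rewrite gt_eqF.
  rewrite powR_inv1 ?divr_ge0 ?sqr_ge0 ?(ltW D0)// invf_div /h.
  by rewrite mulrC.
have hi : leb.-integrable `]0, 1[ (EFin \o h).
  apply: integrable_beta_kernelM => //.
    by apply: measurable_funM => //; exact: measurable_mobius_den_inv.
  move=> t t01; have D0 := mobius_den_gt0 r t01.
  rewrite ger0_norm ?divr_ge0 ?sqr_ge0 ?(ltW D0)// ler_pdivrMr// mul1r.
  rewrite -subr_ge0; have -> : mobius_den r t - (1 - r) ^+ 2 = 4 * r * t.
    by rewrite /mobius_den; ring.
  by have /andP[t0 _] := t01; rewrite !mulr_ge0// ltW.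
have -> : mobius_mean b r = (1 + r ^+ 2) / (2 * r) * Beta b b -
    (1 + r) ^+ 2 / (2 * r) * \int[leb]_(t in `]0, 1[) h t.
  have bi := integrable_beta_kernel b12.
  rewrite /Beta -RintegralZl// -RintegralZl// -RintegralB//; last 2 first.
  - exact: (@integrableZl _ _ _ leb _ _ ((1 + r ^+ 2) / (2 * r)) (EFin \o beta_kernel b)).
  - exact: (@integrableZl _ _ _ leb _ _ ((1 + r) ^+ 2 / (2 * r)) (EFin \o h)).
  apply: eq_Rintegral => t; rewrite inE/= in_itv/= => /(mobius_den_gt0 r) D0.
  rewrite -/(beta_kernel b t) /h /mobius.
  (* Division with remainder of the numerator by the denominator, both affine in t; the two terms
     give the two prefactors of [eta1]. *)
  have -> : mobius_num r t = (1 + r ^+ 2) / (2 * r) * mobius_den r t -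
      (1 + r) ^+ 2 / (2 * r) * (1 - r) ^+ 2.
    by rewrite /mobius_num /mobius_den; field; rewrite gt_eqF.
  by field; rewrite !gt_eqF.
field.
rewrite !gt_eqF//=.
by rewrite ltr_wpDr// sqr_ge0.
Qed.

Lemma eta1_bij (d : nat) : (0 < d)%N -> set_bij `[0, 1[ `[0, 1[ (@eta1 R d).
Proof.
move=> d0.
have b12 : 2^-1 <= d%:R / 2 :> R by rewrite -[leLHS]mul1r ler_pM2r ?invr_gt0// ler1n.
set b := d%:R / 2 in b12.
have B0 := Beta_gt0 b12.
(* [E] agrees with [eta1] on [[0, 1[] and remains continuous up to 1, where it equals 1; this allows
   the intermediate value theorem on the closed interval. *)
pose E r := (Beta b b)^-1 * mobius_mean b r.
have etaE r : 0 <= r < 1 -> eta1 d r = E r by exact: eta1E.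
have E0 : E 0 = 0 by rewrite /E mobius_mean0// mulr0.
have E1 : E 1 = 1 by rewrite /E mobius_mean1 mulVf// gt_eqF.
have Elt r s : 0 <= r -> r < s -> s <= 1 -> E r < E s.
  by move=> *; rewrite ltr_pM2l ?invr_gt0// mobius_mean_lt.
have lt_eta r s : 0 <= r -> r < s -> s < 1 -> eta1 d r < eta1 d s.
  move=> r0 rs s1; rewrite !etaE ?r0 ?s1 ?(lt_trans rs)// ?andbT; last first.
    by rewrite ltW// (le_lt_trans r0).
  by apply: Elt => //; exact: ltW.
split.
- move=> r; rewrite /= !in_itv/= => r01; rewrite etaE//; have /andP[r0 r1] := r01.
  rewrite -[X in _ < X]E1 Elt// andbT -[leLHS]E0.
  by move: r0; rewrite le_eqVlt => /predU1P[<-//|r0]; rewrite ltW// Elt// ltW.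
- move=> r s; rewrite !inE/= !in_itv/= => /andP[r0 r1] /andP[s0 s1] rs.
  apply/eqP; case: ltgtP => // [rs'|sr'].
    by have := lt_eta r s r0 rs' s1; rewrite rs ltxx.
  by have := lt_eta s r s0 sr' r1; rewrite rs ltxx.
- move=> y; rewrite /= in_itv/= => /andP[y0 y1].
  have [||c] := @IVT R E 0 1 y ler01.
  + apply: continuous_subspaceT => r.
    by apply: cvgM; [exact: cvg_cst|exact: continuous_mobius_mean].
  + by rewrite E0 E1 minEle maxEle ler01 y0 ltW.
  rewrite in_itv/= => /andP[c0 c1] Ecy.
  have c1' : c < 1.
    rewrite lt_neqAle c1 andbT; apply/eqP => cE.
    by move: y1; rewrite -Ecy cE E1 ltxx.
  by exists c; rewrite ?etaE ?in_itv/= ?c0.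
Qed.

End eta1_bijection.

(** * Null sets for Lebesgue measure, surface area and the spherical Cauchy law *)

Section null_sets.
Context {R : realType}.
Local Notation leb := (@lebesgue_measure R).

Lemma cons_rV0 n (p : R * 'rV[R]_n) : cons_rV p 0 0 = p.1.
Proof.
rewrite /cons_rV (_ : 0 = lshift n (0 : 'I_1)); last exact/val_inj.
by rewrite (@row_mxEl _ 1 1 n) mxE.
Qed.

Lemma cons_rVS n (p : R * 'rV[R]_n) (i : 'I_n) : cons_rV p 0 (rshift 1 i) = p.2 0 i.
Proof. by rewrite /cons_rV (@row_mxEr _ 1 1 n). Qed.

Lemma measurable_set1_rV n (y : 'rV[R]_n) : measurable [set y].
Proof.
have -> : [set y] = \bigcap_(i in [set: 'I_n]) ((fun v : 'rV[R]_n => v 0 i) @^-1` [set y 0 i]).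
  apply/seteqP; split => [x -> //|x xy].
  by apply/rowP => i; exact: xy.
apply: fin_bigcap_measurable => // i _.
rewrite -[X in measurable X]setTI; exact: measurable_coord.
Qed.

(** Fubini along the first coordinate; one exceptional slice is tolerated because a single point is
    null on the line. *)
Lemma lebesgue_rVS_null n (A : set 'rV[R]_n.+1) (a0 : R) : measurable A ->
  (forall a : R, a != a0 -> lebesgue_rV [set v | A (cons_rV (a, v))] = 0%E) ->
  lebesgue_rV A = 0%E.
Proof.
move=> mA A0.
rewrite /= /pushforward /product_measure1.
have mcA : measurable ((fun p : measurableTypeR R * 'rV[R]_n => cons_rV p) @^-1` A).
  by rewrite -[X in measurable X]setTI; exact: measurable_cons_rV.
transitivity (\int[leb]_(x in [set: measurableTypeR R]) cst 0%E x)%E; last by rewrite integral0.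
apply: ae_eq_integral => //.
  exact: measurable_fun_xsection.
exists [set a0]; split; first exact: measurable_set1.
  exact: lebesgue_measure_set1.
move=> a /= h; apply/eqP; apply: contra_notT h => aa0 _.
rewrite -(A0 a aa0); congr lebesgue_rV; apply/seteqP; split => v /=.
  by rewrite /xsection/= inE.
by rewrite /xsection/= inE.
Qed.

Lemma lebesgue_rV_set1 n (y : 'rV[R]_n.+1) : lebesgue_rV [set y] = 0%E.
Proof.
apply: (lebesgue_rVS_null (a0 := y 0 0)); first exact: measurable_set1_rV.
move=> a ay; rewrite (_ : [set v | _] = set0) ?measure0//.
apply/seteqP; split => v //= vy.
by move: ay; rewrite -vy cons_rV0 eqxx.
Qed.

Lemma enormZ n (c : R) (v : 'rV[R]_n) : enorm (c *: v) = `|c| * enorm v.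
Proof.
rewrite /enorm -sqrtr_sqr -sqrtrM ?sqr_ge0//; congr Num.sqrt.
by rewrite mulr_sumr; apply: eq_bigr => i _; rewrite mxE exprMn.
Qed.

Lemma enorm_direction n (v : 'rV[R]_n) : 0 < enorm v -> enorm (direction v) = 1.
Proof.
by move=> v0; rewrite enormZ ger0_norm ?invr_ge0 ?(ltW v0)// mulVf// gt_eqF.
Qed.

Lemma scale_direction n (v : 'rV[R]_n) : 0 < enorm v -> enorm v *: direction v = v.
Proof. by move=> v0; rewrite scalerA divff ?scale1r// gt_eqF. Qed.

(** The cone over a point lies on a ray, which meets each slice with first coordinate a != 0 in at
    most one point. The ambient dimension is at least 2, so the slices have dimension at least 1 and
    points are null in them. *)
Lemma surface_area_set1 n (y : 'rV[R]_n.+2) : surface_area [set y] = 0%E.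
Proof.
rewrite /surface_area; set A := _ `&` _.
suff -> : lebesgue_rV A = 0%E by rewrite mule0.
apply: (lebesgue_rVS_null (a0 := 0)).
  apply: measurableI; first exact: measurable_punctured_ball.
  rewrite -[X in measurable X]setTI; apply: measurable_direction => //.
  exact: measurable_set1_rV.
move=> a a0; set S := [set v | _].
(* On the ray x = c y, the first coordinate forces c = a / y_0; when y_0 = 0 the slice is empty. *)
pose v0 : 'rV[R]_n.+1 := \row_i (a / y 0 0 * y 0 (rshift 1 i)).
have : S `<=` [set v0].
  move=> v [/= /andP[x0 _]]; set x := cons_rV (a, v) in x0 * => xy.
  have xE : x = enorm x *: y by rewrite -xy scale_direction.
  have aE : a = enorm x * y 0 0 by rewrite -[LHS](cons_rV0 (a, v)) -/x {1}xE mxE.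
  have y0 : y 0 0 != 0 by apply: contraNneq a0 => y0; rewrite aE y0 mulr0.
  apply/rowP => i; rewrite mxE {1}aE mulfK//.
  by rewrite -[LHS](cons_rVS (a, v)) -/x {1}xE mxE.
case/subset_set1 => ->; first exact: measure0.
exact: lebesgue_rV_set1.
Qed.

Lemma surface_area_unit_sphereC n : surface_area [set y : 'rV[R]_n | enorm y != 1] = 0%E.
Proof.
rewrite /surface_area (_ : _ `&` _ = set0) ?measure0 ?mule0//.
apply/seteqP; split => x //= -[/andP[x0 _]].
by rewrite enorm_direction// eqxx.
Qed.

Lemma measurable_spherical_cauchy_density d (phi : 'rV[R]_d.+1) :
  measurable_fun setT (spherical_cauchy_density phi).
Proof.
rewrite /spherical_cauchy_density.
apply: measurable_funM => //; apply: measurable_funX; apply: measurable_funM => //.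
have -> : (fun y : 'rV[R]_d.+1 => (enorm (y - phi) ^+ 2)^-1) =
    (fun y => (enorm (y - phi) ^+ 2) `^ (-1)).
  by apply/funext => y; rewrite powR_inv1// sqr_ge0.
apply: (measurableT_comp (measurable_powR (-1))).
apply: measurable_funX; apply: (measurableT_comp (@measurable_enorm R d.+1)).
apply: measurable_fun_rVP => i.
have -> : (fun t : 'rV[R]_d.+1 => (t - phi) 0 i) = (fun t => t 0 i - phi 0 i).
  by apply/funext => t; rewrite !mxE.
by apply: measurable_funB => //; exact: measurable_coord.
Qed.

Lemma spherical_cauchy_null d (phi : 'rV[R]_d.+1) A : measurable A ->
  surface_area A = 0%E -> spherical_cauchy phi A = 0%E.
Proof.
move=> mA A0; apply: null_set_integral => //.
apply/measurable_EFinP; apply: measurable_funTS.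
exact: measurable_spherical_cauchy_density.
Qed.

End null_sets.

(** * Norms of means of unit vectors, and the solution of the moment equation *)

Section moment_equation.
Context {R : realType}.

(** The variance identity in pairwise form, applied below to each coordinate. *)
Lemma sum_sqr_sub n (a : 'I_n -> R) :
  \sum_i \sum_j (a i - a j) ^+ 2 = 2 * (n%:R * \sum_i a i ^+ 2 - (\sum_i a i) ^+ 2).
Proof.
have -> : \sum_i \sum_j (a i - a j) ^+ 2 =
    \sum_i (n%:R * a i ^+ 2 + \sum_j a j ^+ 2 - 2 * a i * \sum_j a j).
  apply: eq_bigr => i _; rewrite mulr_sumr -sumrN.
  have -> : n%:R * a i ^+ 2 = \sum_(j < n) a i ^+ 2.
    by rewrite sumr_const card_ord mulr_natl.
  by rewrite -!big_split/=; apply: eq_bigr => j _; ring.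
rewrite big_split/= sumrN -mulr_suml -mulr_sumr big_split/= -mulr_sumr sumr_const card_ord.
by rewrite -mulr_natl; ring.
Qed.

Lemma enorm_sqr n (v : 'rV[R]_n) : enorm v ^+ 2 = \sum_i v 0 i ^+ 2.
Proof. by rewrite sqr_sqrtr// sumr_ge0// => i _; rewrite sqr_ge0. Qed.

Lemma enorm_eq0 n (v : 'rV[R]_n) : enorm v = 0 -> v = 0.
Proof.
move=> v0; have := enorm_sqr v; rewrite v0 expr0n/= => /esym/eqP.
rewrite psumr_eq0; last by move=> i _; rewrite sqr_ge0.
move=> /allP h; apply/rowP => i; rewrite mxE.
by have := h i (mem_index_enum i); rewrite /= sqrf_eq0 => /eqP.
Qed.

Lemma enorm0 n : enorm (0 : 'rV[R]_n) = 0.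
Proof. by rewrite -(scale0r (0 : 'rV[R]_n)) enormZ normr0 mul0r. Qed.

(** For unit vectors the pairwise squared distances add up to 2 (n^2 - ||S||^2), with S their sum;
    one distinct pair makes this positive. *)
Lemma enorm_mean_lt1 n m (v : 'I_n -> 'rV[R]_m) (i0 j0 : 'I_n) :
  (forall i, enorm (v i) = 1) -> v i0 != v j0 ->
  enorm (n%:R^-1 *: \sum_i v i) < 1.
Proof.
move=> v1 vij; have n0 : (0 < n)%N by apply: leq_ltn_trans (ltn_ord i0).
have n0' : 0 < n%:R :> R by rewrite ltr0n.
have D (u w : 'rV[R]_m) : enorm (u - w) ^+ 2 = \sum_k (u 0 k - w 0 k) ^+ 2.
  by rewrite enorm_sqr; apply: eq_bigr => k _; rewrite !mxE.
have key : \sum_i \sum_j enorm (v i - v j) ^+ 2 =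
    2 * (n%:R ^+ 2 - enorm (\sum_i v i) ^+ 2).
  under eq_bigr => i _ do under eq_bigr => j _ do rewrite D.
  under eq_bigr => i _ do rewrite exchange_big/=.
  rewrite exchange_big/=.
  under eq_bigr => k _ do rewrite sum_sqr_sub.
  rewrite -mulr_sumr sumrB -mulr_sumr exchange_big/=.
  under [X in _ * X - _]eq_bigr => i _ do rewrite -enorm_sqr v1 expr1n.
  rewrite sumr_const card_ord -[1 *+ n]/(n%:R) -expr2 enorm_sqr.
  by congr (_ * (_ - _)); apply: eq_bigr => k _; rewrite summxE.
have pos : 0 < \sum_i \sum_j enorm (v i - v j) ^+ 2.
  rewrite (bigD1 i0)//= (bigD1 j0)//= -addrA ltr_pwDl//.
    rewrite exprn_gt0// lt_neqAle enorm_ge0 andbT eq_sym; apply: contraNneq vij.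
    by move=> /enorm_eq0/eqP; rewrite subr_eq0.
  by rewrite addr_ge0// sumr_ge0// => i _; rewrite ?sumr_ge0// => *; rewrite sqr_ge0.
rewrite enormZ ger0_norm ?invr_ge0 ?ler0n// ltr_pdivrMl// mulr1.
rewrite -ltr_sqr ?nnegrE ?enorm_ge0 ?ler0n//.
by move: pos; rewrite key pmulr_rgt0// subr_gt0.
Qed.

Lemma moment_equation_solution (d : nat) (ybar : 'rV[R]_d.+1) :
  (0 < d)%N -> enorm ybar < 1 ->
  let phi := eta1_inv d (enorm ybar) *: direction ybar in
  [/\ enorm phi < 1, moment_equation phi ybar
    & forall psi : 'rV[R]_d.+1,
        enorm psi < 1 -> moment_equation psi ybar -> psi = phi].
Proof.
move=> d0 y1; have [fe ie se] := @eta1_bij R d d0.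
have inI (r : R) : 0 <= r -> r < 1 -> (`[0, 1[%classic : set R) r.
  by rewrite /= in_itv/= => -> ->.
have eta0 : @eta1 R d 0 = 0 by rewrite /eta1 eqxx.
have [x xI xy] := se _ (inI _ (enorm_ge0 ybar) y1).
have -> : eta1_inv d (enorm ybar) = x.
  by rewrite -xy /eta1_inv pinvKV// inE.
have [x0 x1] : 0 <= x /\ x < 1 by move: xI; rewrite /= in_itv/= => /andP[].
have eta_inj (r s : R) : 0 <= r < 1 -> 0 <= s < 1 -> eta1 d r = eta1 d s -> r = s.
  move=> /andP[r0 r1] /andP[s0 s1].
  exact: (ie r s (mem_set (inI r r0 r1)) (mem_set (inI s s0 s1))).
rewrite /moment_equation /=.
(* A zero mean has no genuine direction: [direction] is 0 there, the candidate is 0, and injectivity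
   of [eta1] together with [eta1 d 0 = 0] excludes any nonzero solution. *)
have [y0|yN0] := eqVneq (enorm ybar) 0.
  have {xy y0}ybar0 : ybar = 0 by exact: enorm_eq0.
  rewrite ybar0 /direction scaler0 scaler0 enorm0 eta0 scale0r; split => // psi psi1.
  move=> /(congr1 (@enorm R _)); rewrite enorm0 enormZ.
  have [->//|psiN0] := eqVneq psi 0.
  have psi_gt0 : 0 < enorm psi.
    by rewrite lt_neqAle enorm_ge0 andbT eq_sym; apply: contraNneq psiN0 => /enorm_eq0/eqP.
  rewrite enorm_direction// mulr1.
  move/eqP; rewrite normr_eq0 => /eqP; rewrite -[RHS]eta0 => /eta_inj -/(_ _ _) psi0.
  by apply: enorm_eq0; apply: psi0; rewrite ?enorm_ge0 ?lexx ?ltr01.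
have y0 : 0 < enorm ybar by rewrite lt_neqAle enorm_ge0 andbT eq_sym.
have xN0 : x != 0 by apply: contraNneq yN0 => xE; rewrite -xy xE eta0.
have ex : enorm (x *: direction ybar) = x.
  by rewrite enormZ enorm_direction// mulr1 ger0_norm.
have dx : direction (x *: direction ybar) = direction ybar.
  by rewrite {1}/direction ex scalerA mulVf// scale1r.
rewrite ex dx xy scale_direction//; split => // psi psi1 psiE.
have psi_gt0 : 0 < enorm psi.
  rewrite lt_neqAle enorm_ge0 andbT; apply: contraNneq yN0 => psi0.
  by rewrite -psiE -psi0 eta0 scale0r enorm0.
(* Nonnegativity removes the absolute value when norms are taken in the equation, and so fixes the
   norm of [psi], then its direction. *)
have eta_ge0 : 0 <= eta1 d (enorm psi).
  by have := fe _ (inI _ (ltW psi_gt0) psi1); rewrite /= in_itv/= => /andP[].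
have eta_psi : eta1 d (enorm psi) = enorm ybar.
  by rewrite -psiE enormZ enorm_direction// mulr1 ger0_norm.
have <- : enorm psi = x.
  apply: eta_inj; [by rewrite enorm_ge0|by rewrite x0|by rewrite eta_psi xy].
have <- : direction psi = direction ybar.
  by rewrite [RHS]/direction -{2}psiE eta_psi scalerA mulVf// scale1r.
by rewrite scale_direction.
Qed.

End moment_equation.

(** * Coincidence of two independent variables *)

Section independence.
Context d d' {T : measurableType d} {T' : measurableType d'} {R : realType}.
Variables (P : probability T R) (X Y : {RV P >-> T'}).

(** By uniqueness of product measures the joint law is the product of the marginals; each slice of
    the diagonal is a singleton, null for the law of [Y]. *)
Lemma independent_eq_null :
  measurable [set p : T' * T' | p.1 = p.2] ->
  (forall A B, measurable A -> measurable B ->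
    P (X @^-1` A `&` Y @^-1` B) = P (X @^-1` A) * P (Y @^-1` B))%E ->
  (forall y, P (Y @^-1` [set y]) = 0%E) ->
  P [set w | X w = Y w] = 0%E.
Proof.
move=> mD indep Y0.
have mZ : measurable_fun setT (fun w => (X w, Y w)).
  by apply: measurable_fun_pair.
pose Z : {mfun T >-> (T' * T')%type} := mfun_Sub (mem_set mZ).
have -> : P [set w | X w = Y w] = distribution P Z [set p | p.1 = p.2] by [].
rewrite -(@product_measure_unique _ _ _ _ _ (distribution P X) (distribution P Y)
  (distribution P Z))//.
rewrite /product_measure1 integral0_eq// => x _ /=.
rewrite (_ : xsection _ _ = [set x]); first exact: Y0.
by apply/seteqP; split => y; rewrite /xsection/= inE/= => ->.
Qed.

End independence.

(** * Almost sure properties of a spherical Cauchy sample *)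

Section spherical_cauchy_sample.
Context {R : realType} (d n : nat).
Context {disp : measure_display} {T : measurableType disp} (P : probability T R).
Variables (phi : 'rV[R]_d.+1) (Y : 'I_n -> {RV P >-> 'rV[R]_d.+1}).
Hypothesis hY : random_sample Y (spherical_cauchy phi).

Lemma sample_null i (A : set 'rV[R]_d.+1) : measurable A ->
  surface_area A = 0%E -> P (Y i @^-1` A) = 0%E.
Proof.
move=> mA A0; have := hY.2 i A mA.
by rewrite spherical_cauchy_null.
Qed.

Lemma sample_norm1 : {ae P, forall w, forall i, enorm (Y i w) = 1}.
Proof.
apply: filter_forall => i.
have mA : measurable [set y : 'rV[R]_d.+1 | enorm y != 1].
  have -> : [set y : 'rV[R]_d.+1 | enorm y != 1] = (@enorm R d.+1) @^-1` (~` [set 1]).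
    by apply/seteqP; split => y /= /eqP.
  rewrite -[X in measurable X]setTI; apply: measurable_enorm => //.
  exact: measurableC.
exists (Y i @^-1` [set y | enorm y != 1]); split => //.
- by rewrite -[X in measurable X]setTI; exact: measurable_funPT.
- exact/sample_null/surface_area_unit_sphereC.
- by move=> w /eqP.
Qed.

Lemma sample_neq (hd : (0 < d)%N) i j : i != j -> {ae P, forall w, Y i w != Y j w}.
Proof.
move=> ij.
have mD : measurable [set p : 'rV[R]_d.+1 * 'rV[R]_d.+1 | p.1 = p.2].
  have -> : [set p : 'rV[R]_d.+1 * 'rV[R]_d.+1 | p.1 = p.2] =
      \bigcap_(k in [set: 'I_d.+1]) ((fun p : 'rV[R]_d.+1 * 'rV[R]_d.+1 =>
         p.1 0 k - p.2 0 k) @^-1` [set 0]).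
    apply/seteqP; split => [p /= pE k _ /=|p pE /=]; first by rewrite pE subrr.
    by apply/rowP => k; apply/eqP; rewrite -subr_eq0; apply/eqP; exact: pE.
  apply: fin_bigcap_measurable => // k _.
  have mk : measurable_fun setT (fun p : 'rV[R]_d.+1 * 'rV[R]_d.+1 => p.1 0 k - p.2 0 k).
    apply: measurable_funB.
      exact: (measurableT_comp (measurable_coord k) measurable_fst).
    exact: (measurableT_comp (measurable_coord k) measurable_snd).
  by rewrite -[X in measurable X]setTI; apply: mk => //; exact: measurable_set1.
have P0 : P [set w | Y i w = Y j w] = 0%E.
  apply: independent_eq_null => // [A B mA mB|y].
    (* Pairwise independence is mutual independence for the index set {i, j}. *)
    have := hY.1 [set i; j]%SET (fun k => if k == i then A else B).
    have ji : (j == i) = false by rewrite eq_sym (negbTE ij).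
    rewrite big_setU1 ?inE//= big_set1 eqxx ji => <-; last by move=> k; case: ifP.
    congr (P _); apply/seteqP; split => w /=.
      move=> [wA wB] k /=; rewrite !inE => /orP[] /eqP ->; first by rewrite eqxx.
      by rewrite ji.
    move=> h; split.
      by have := h i; rewrite /= !inE eqxx => /(_ isT).
    by have := h j; rewrite /= !inE eqxx orbT ji => /(_ isT).
  apply: sample_null; first exact: measurable_set1_rV.
  (* Positivity of d enters here: on the two-point sphere S^0 points are not null. *)
  by case: (d) hd y => // m _ y; exact: surface_area_set1.
exists [set w | Y i w = Y j w]; split => //.
  have -> : [set w | Y i w = Y j w] =
     (fun w => (Y i w, Y j w)) @^-1` [set p | p.1 = p.2] by [].
  rewrite -[X in measurable X]setTI; apply: measurable_fun_pair => //.
by move=> w /= /negP; rewrite negbK => /eqP.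
Qed.

End spherical_cauchy_sample.

Theorem theorem7 (R : realType) (d : nat) (hd : (0 < d)%N)
    (n : nat) (hn : (1 < n)%N)
    (disp : measure_display) (T : measurableType disp) (P : probability T R)
    (phi : 'rV[R]_d.+1) (hphi : enorm phi < 1)
    (Y : 'I_n -> {RV P >-> 'rV[R]_d.+1})
    (hY : random_sample Y (spherical_cauchy phi)) :
  set_bij `[0, 1[ `[0, 1[ (@eta1 R d) /\
  {ae P, forall w,
    let ybar := sample_mean Y w in
    let phi_MM := eta1_inv d (enorm ybar) *: direction ybar in
    [/\ enorm phi_MM < 1,
        moment_equation phi_MM ybar
      & forall psi : 'rV[R]_d.+1,
          enorm psi < 1 -> moment_equation psi ybar -> psi = phi_MM]}.
Proof.
split; first exact: eta1_bij.
(* Two distinct indices exist because n > 1; the mean of a single observation would lie on the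
   sphere itself. *)
have hn0 := ltnW hn; pose i0 := Ordinal hn0; pose j0 := Ordinal hn.
have ij : i0 != j0 by [].
apply: filterS2 (sample_norm1 hY) (sample_neq hY hd ij) => w w1 wij.
apply: moment_equation_solution => //.
exact: enorm_mean_lt1 w1 wij.
Qed.
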